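(* Let $S$ be a (commutative, unital) semiring and let $n$ be a positive integer. The monoid $UT_n(S)$ of upper triangular $n\times n$ matrices over $S$ (under matrix multiplication) is regular if and only if $n=1$ and the multiplicative reduct $(S,\cdot)$ is regular.
   Context: A semiring is a commutative monoid $(S,+,0)$ with an associative multiplication distributing over addition on both sides, for which $0$ is absorbing ($0a=a0=0$ for all $a\in S$). All semirings are assumed to be commutative (under multiplication) and unital, i.e. to contain a multiplicative identity $1$. $UT_n(S)$ is the set of all $n\times n$ matrices over $S$ all of whose entries below the main diagonal are $0$, with the usual matrix multiplication. A semigroup $T$ is regular if for each $a\in T$ there is $x\in T$ with $axa=a$.
   Formalization: The semiring S is assumed nontrivial (1 ≠ 0); over the zero semiring UT_n(S) is a one-element monoid, hence regular for every n, so the statement as written fails for n ≥ 2. *)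

(* Defs.v *)
(* Everything is defined over [pzSemiRingType], where 1 = 0 is allowed. Over the
   zero semiring each UT n S is a one-element monoid, hence regular, so that
   characterizing the n for which UT n S is regular requires 1 != 0
   ([comNzSemiRingType]). *)
From HB Require Import structures.
From mathcomp Require Import all_boot all_order all_algebra.

Set Implicit Arguments.
Unset Strict Implicit.
Unset Printing Implicit Defensive.

Import GRing.Theory.
Local Open Scope ring_scope.

Definition regular_semigroup (T : semigroupType) : Prop :=
  forall a : T, exists x : T, (a * x * a)%g = a.

Definition mul_reduct (S : pzSemiRingType) : Type := S.

HB.instance Definition _ (S : pzSemiRingType) :=
  Choice.copy (mul_reduct S) S.
HB.instance Definition _ (S : pzSemiRingType) :=
  isMonoid.Build (mul_reduct S) (@mulrA S) (@mul1r S) (@mulr1 S).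

(* The library's [is_trig_mx] means lower triangular. *)
Definition is_upper_trig_mx (S : pzSemiRingType) (n : nat) (A : 'M[S]_n) :=
  [forall i : 'I_n, forall j : 'I_n, (j < i)%N ==> (A i j == 0)].

Lemma is_upper_trig_mxP (S : pzSemiRingType) (n : nat) (A : 'M[S]_n) :
  reflect (forall i j : 'I_n, (j < i)%N -> A i j = 0) (is_upper_trig_mx A).
Proof.
apply: (iffP 'forall_forallP) => hA i j; last by apply/implyP => /hA->.
by move/(implyP (hA i j))/eqP.
Qed.

Record UT (n : nat) (S : pzSemiRingType) : Type := MkUT {
  UT_val : mul_reduct 'M[S]_n;
  _ : is_upper_trig_mx UT_val
}.

HB.instance Definition _ n S := [isSub for @UT_val n S].
HB.instance Definition _ n S := [Choice of UT n S by <:].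

Fact UT_monoid_closed n (S : pzSemiRingType) :
  monoid_closed (@is_upper_trig_mx S n : {pred mul_reduct 'M[S]_n}).
Proof.
split=> [|A B /is_upper_trig_mxP hA /is_upper_trig_mxP hB].
  by apply/is_upper_trig_mxP => i j ji; rewrite mxE -val_eqE gtn_eqF.
apply/is_upper_trig_mxP => i j ji; rewrite mxE big1 // => k _.
have [ki|ik] := ltnP k i; first by rewrite hA ?mul0r.
by rewrite hB ?mulr0 // (leq_trans ji).
Qed.

HB.instance Definition _ n (S : pzSemiRingType) :=
  SubChoice_isSubMonoid.Build (mul_reduct 'M[S]_n) (@is_upper_trig_mx S n)
    (UT n S) (UT_monoid_closed n S).

(* Main.v *)
Require Import Defs.
From mathcomp Require Import all_boot all_order all_algebra.

(** For i < j the matrix unit E_ij is upper triangular, and for every X one has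
    E_ij X E_ij = X_ji E_ij. When X is upper triangular X_ji = 0, so E_ij, being
    nonzero because 1 != 0, has no inner inverse inside UT n S. Such i and j
    exist as soon as 1 < n ([UT_not_regular]). For n = 1 the single entry gives
    an isomorphism from UT 1 S to the multiplicative reduct of S, so regularity
    passes between the two ([UT1_regular]). *)

Set Implicit Arguments.
Unset Strict Implicit.
Unset Printing Implicit Defensive.

Import GRing.Theory.
Local Open Scope ring_scope.

(** Multiplying by E_ij on the left and on the right moves the (j, i) entry of X,
    which lies on the other side of the diagonal, to position (i, j). *)
Lemma delta_mx_sandwich (S : pzSemiRingType) (n : nat) (i j : 'I_n)
    (X : 'M[S]_n) :
  (delta_mx i j *m X *m delta_mx i j) i j = X j i.
Proof.
rewrite mxE (bigD1 i) //= big1 => [|k /negPf ki]; last first.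
  by rewrite [delta_mx _ _ _ _]mxE ki mulr0.
rewrite addr0 [delta_mx i j i j]mxE !eqxx mulr1 mxE (bigD1 j) //= big1.
  by rewrite addr0 mxE !eqxx mul1r.
by move=> k /negPf kj; rewrite mxE kj andbF mul0r.
Qed.

(** Passes from the product of the monoid UT n S to the matrix product, to which
    the entrywise rules apply. *)
Lemma UT_val_mul (S : pzSemiRingType) (n : nat) (A B : UT n S) :
  UT_val (A * B)%g = (UT_val A : 'M[S]_n) *m (UT_val B : 'M[S]_n).
Proof. by []. Qed.

Lemma delta_mx_upper_trig (S : pzSemiRingType) (n : nat) (i j : 'I_n) :
  (i < j)%N -> is_upper_trig_mx (delta_mx i j : 'M[S]_n).
Proof.
move=> ij; apply/is_upper_trig_mxP => k l lk; rewrite mxE.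
by case: eqP => // ki; case: eqP => // lj; move: lk; rewrite ki lj ltnNge ltnW.
Qed.

(** The witness is E_ij at positions 0 and 1: an inner inverse X of it would give
    1 = X_ji = 0. *)
Lemma UT_not_regular (S : nzSemiRingType) (n : nat) :
  (1 < n)%N -> ~ regular_semigroup (UT n S).
Proof.
move=> n_gt1 reg.
pose i : 'I_n := Ordinal (ltnW n_gt1); pose j : 'I_n := Ordinal n_gt1.
have ij : (i < j)%N by [].
have [X /(congr1 (@UT_val n S))] :=
  reg (MkUT (delta_mx_upper_trig S ij)).
have /is_upper_trig_mxP upX := valP X.
rewrite !UT_val_mul /= => /matrixP/(_ i j).
rewrite delta_mx_sandwich upX // mxE !eqxx => /eqP.
by rewrite eq_sym oner_eq0.
Qed.

Lemma mx1_upper_trig (S : pzSemiRingType) (A : 'M[S]_1) : is_upper_trig_mx A.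
Proof. by apply/is_upper_trig_mxP => i j; rewrite !ord1. Qed.

(** The product of two 1 x 1 matrices is the product of their entries, so inner
    inverses correspond under reading off the entry. *)
Lemma UT1_regular (S : pzSemiRingType) :
  regular_semigroup (UT 1 S) <-> regular_semigroup (mul_reduct S).
Proof.
split=> reg => [a | [A upA]].
  have [X /(congr1 (@UT_val 1 S))] := reg (MkUT (mx1_upper_trig (const_mx a))).
  rewrite !UT_val_mul /= => /matrixP/(_ ord0 ord0).
  rewrite !mxE big_ord1 !mxE big_ord1 !mxE => axa.
  by exists ((UT_val X : 'M[S]_1) ord0 ord0).
have [x axa] := reg ((A : 'M[S]_1) ord0 ord0).
exists (MkUT (mx1_upper_trig (const_mx (x : S)))); apply: val_inj.
rewrite [LHS]UT_val_mul UT_val_mul /=; apply/matrixP => i j.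
by rewrite !ord1 !mxE big_ord1 !mxE big_ord1 !mxE.
Qed.

Theorem proposition3p4 (S : comNzSemiRingType) (n : nat) (n_gt0 : (0 < n)%N) :
  regular_semigroup (UT n S) <->
  n = 1%N /\ regular_semigroup (mul_reduct S).
Proof.
split=> [reg | [-> /UT1_regular //]].
have n1 : n = 1%N.
  apply/eqP; rewrite eqn_leq n_gt0 andbT leqNgt; apply/negP => n_gt1.
  exact: UT_not_regular n_gt1 reg.
by split=> //; apply/UT1_regular; rewrite -n1.
Qed.
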